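(* Let $a,b,g,h$ be real functions that are Lebesgue measurable and locally essentially bounded, with $a(t)\ge 0$, $b(t)\ge 0$, $g(t)\le t$, $h(t)\ge t$ and $\lim_{t\to\infty} g(t)=\infty$. Suppose $b(t)\ge a(t)$. Then the following three conditions are equivalent: 1. The differential inequality $$\dot{x}(t)+a(t)x(g(t))-b(t)x(h(t))\ge 0,\quad t\ge t_0,$$ has an eventually positive solution with an eventually nonnegative derivative. 2. The integral inequality $$u(t)\ge b(t)\exp\left\{\int_t^{h(t)}u(s)\,ds\right\}-a(t)\exp\left\{-\int_{g(t)}^t u(s)\,ds\right\},\quad t\ge t_1,$$ with $u(t)=0$ for $t<t_1$, has a nonnegative locally integrable solution $u$ for some $t_1\ge t_0$. 3. The differential equation $$\dot{x}(t)+a(t)x(g(t))-b(t)x(h(t))=0,\quad t\ge t_0,$$ has an eventually positive solution with an eventually nonnegative derivative.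
   Context: The functions $a,b,g,h$ are considered for $t\ge t_0$. A solution of the differential equation is a function $x:\mathbb{R}\to\mathbb{R}$, absolutely continuous on each interval $[t_0,c]$, which satisfies the equation for almost all $t\in[t_0,\infty)$ and satisfies $x(t)=\varphi(t)$ for $t<t_0$, $x(t_0)=x_0$, for some initial function $\varphi$ and initial value $x_0$. Solutions of the differential inequality are understood in the same sense. ''Eventually'' means for all sufficiently large $t$; sign conditions on derivatives are understood almost everywhere.
   Formalization: In conditions 1 and 3 the solution is required only on [T,∞) for some T ≥ t0 (initial data before T), not from t0 itself; with t0 forced, condition 2 does not imply 1 or 3, since a solution on [t1,∞) need not extend back to t0. *)

(* Defs.v *)
From HB Require Import structures.
From mathcomp Require Import all_boot all_order all_algebra.
From mathcomp Require Import all_classical all_reals all_analysis.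

Set Implicit Arguments.
Unset Strict Implicit.
Unset Printing Implicit Defensive.

Import Order.TTheory GRing.Theory Num.Theory.
Import numFieldNormedType.Exports.

Local Open Scope classical_set_scope.
Local Open Scope ring_scope.

(* [R] with the sigma-algebra of all Lebesgue measurable sets; the library's
   default structure on [R] only has the Borel sets. *)
Notation lebesgueTypeR R := (caratheodory_type (mu_ext (wlength (@idfun R)))).

Notation leb R := (@completed_lebesgue_measure R).

Definition lebesgue_measurable_fun (R : realType) (D : set R) (f : R -> R) :=
  @measurable_fun _ _ (lebesgueTypeR R) R D f.

Definition locally_ess_bounded (R : realType) (t0 : R) (f : R -> R) :=
  forall c, exists M : R,
    {ae leb R, forall t, t \in `[t0, c] -> `|f t| <= M}.

Definition locally_integrableR (R : realType) (u : R -> R) :=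
  forall c d : R, (leb R).-integrable `[c, d] (EFin \o u).

(* Absolute continuity on [[a, b]]; it holds vacuously if [b < a]. *)
Definition absolutely_continuous (R : realType) (a b : R) (f : R -> R) :=
  forall e : R, 0 < e -> exists2 d : R, 0 < d &
    forall (n : nat) (I : 'I_n -> R * R),
      (forall i, [/\ a <= (I i).1, (I i).1 <= (I i).2 & (I i).2 <= b]) ->
      trivIset setT (fun i => `](I i).1, (I i).2[%classic) ->
      \sum_i ((I i).2 - (I i).1) < d ->
      \sum_i `|f (I i).2 - f (I i).1| < e.

(* x'(t) + a(t) x(g(t)) - b(t) x(h(t)) *)
Definition mixed_op (R : realType) (a b g h x : R -> R) (t : R) : R :=
  derive1 x t + a t * x (g t) - b t * x (h t).

(* Solutions on [[T, +oo[]. The initial function is the restriction of [x] to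
   [t < T] and the initial value is [x T]; both are arbitrary. The starting
   point is a parameter because a solution on [[T, +oo[] need not extend
   backwards: the equation has deviating arguments on both sides of [t]. *)
Definition equation_solution (R : realType) (a b g h : R -> R) (T : R)
    (x : R -> R) :=
  (forall c, absolutely_continuous T c x) /\
  {ae leb R, forall t, T <= t -> derivable x t 1 /\ mixed_op a b g h x t = 0}.

Definition inequality_solution (R : realType) (a b g h : R -> R) (T : R)
    (x : R -> R) :=
  (forall c, absolutely_continuous T c x) /\
  {ae leb R, forall t, T <= t -> derivable x t 1 /\ 0 <= mixed_op a b g h x t}.

Definition eventually_pos_nondecr (R : realType) (x : R -> R) :=
  (\forall t \near +oo, 0 < x t) /\
  exists S : R, {ae leb R, forall t, S <= t -> 0 <= derive1 x t}.

(* The inequality is pointwise: altering [u] on a null set does not change the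
   integrals, so this is no more restrictive than an almost everywhere one. *)
Definition integral_inequality_solution (R : realType) (a b g h : R -> R)
    (t1 : R) (u : R -> R) :=
  [/\ locally_integrableR u,
      forall t, 0 <= u t,
      forall t, t < t1 -> u t = 0 &
      forall t, t1 <= t ->
        b t * expR (\int[leb R]_(s in `[t, h t]) u s) -
        a t * expR (- \int[leb R]_(s in `[g t, t]) u s) <= u t].

(* Main.v *)
Require Import Defs.
From HB Require Import structures.
From mathcomp Require Import all_boot all_order all_algebra.
From mathcomp Require Import all_classical all_reals all_analysis.
From mathcomp Require Import measurable_realfun ring lra.

(** Both the inequality and the equation are encoded, through the substitution
    [x = exp (int u)], by the operator

      [F u t = b t * exp (int_t^(h t) u) - a t * exp (- int_(g t)^t u)]

    for [t >= t1], extended by [0] ([picard]).  An equation solution is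
    [x = exp (int u)] with [u = F u], and condition 2 says [F u <= u].  The
    operator is monotone, and [F 0 >= 0] because [a <= b], so the iterates
    [u_n = F^n 0] form a nondecreasing sequence of nonnegative functions.  All
    conditions are reduced to the existence of a fixed point of [F].

    The iterates converge to a fixed point as soon as a single nondecreasing
    function [y] satisfies [int_s^t u_n <= y t - y s] for all [n] and all
    [s <= t] ([picard_fixpoint]): then [u_n t <= b t * exp (y (h t) - y t)], a
    locally essentially bounded function since [b] and [h] are, and monotone
    convergence passes to the limit under the integrals.  Such a [y] is
    available under either hypothesis.
    - If [F w <= w], then [u_n <= w] by monotonicity and [y] is the primitive
      of [w] ([integral_inequality_fixpoint]).
    - If [x] is a positive nondecreasing solution of the differential
      inequality, then [y = ln x] for [t >= t1] ([supersolution_fixpoint]).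
      Inductively, [int u_n <= y t - y s] turns the differential inequality
      into [F u_n <= x' / x = y'] almost everywhere; so
      [y - int (F u_n)] is absolutely continuous with a nonnegative derivative
      and therefore nondecreasing.
    Only the locally bounded functions [F u_n] are integrated, never [x' / x]
    itself: its regularity enters through [y] alone.

    Two analytic facts carry the argument.  An absolutely continuous function
    whose derivative is nonnegative almost everywhere is nondecreasing
    ([ac_derive1_ge0_le]); this is proved with a covering of the exceptional
    null set and induction along the interval.  A primitive is almost
    everywhere differentiable with the expected derivative
    ([cumul_derivable]); this is the Lebesgue differentiation theorem for the
    Borel sigma-algebra, transported to Lebesgue measurable functions by
    means of Borel representatives ([borel_representative]). *)

Set Implicit Arguments.
Unset Strict Implicit.
Unset Printing Implicit Defensive.

Import Order.TTheory GRing.Theory Num.Theory.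
Import numFieldNormedType.Exports.

Local Open Scope classical_set_scope.
Local Open Scope ring_scope.

(** * Lebesgue measurable and Borel functions *)

Local Notation bor R := (@lebesgue_measure R).

Lemma ae_mono d (T : measurableType d) (R : realType)
    (mu : {measure set T -> \bar R}) (P Q : T -> Prop) :
  (forall t, P t -> Q t) -> {ae mu, forall t, P t} -> {ae mu, forall t, Q t}.
Proof. by move=> PQ; apply: filterS. Qed.

Lemma ae_and d (T : measurableType d) (R : realType)
    (mu : {measure set T -> \bar R}) (P Q : T -> Prop) :
  {ae mu, forall t, P t} -> {ae mu, forall t, Q t} ->
  {ae mu, forall t, P t /\ Q t}.
Proof. by move=> aeP aeQ; apply: filterI. Qed.

(** A null set for the completed measure has a Borel null hull, because both
    measures are restrictions of the same outer measure. *)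
Lemma ae_leb_bor (R : realType) (P : R -> Prop) :
  {ae leb R, forall t, P t} <-> {ae bor R, forall t, P t}.
Proof.
split=> [[A [mA A0 PA]]|[A [mA A0 PA]]].
- have nA : (bor R).-negligible A by apply/negligible_outer_measure; exact: A0.
  exact: negligibleS nA.
- exists A; split => //; exact: sub_caratheodory.
Qed.

Lemma measurable_id_leb (R : realType) :
  measurable_fun [set: lebesgueTypeR R]
    (id : lebesgueTypeR R -> measurableTypeR R).
Proof.
by move=> _ Y mY; rewrite setTI; exact: sub_caratheodory.
Qed.

Lemma leb_measurable_decomp (R : realType) (E : set R) :
  measurable (E : set (lebesgueTypeR R)) ->
  exists F M : set R,
    [/\ measurable F, measurable M, bor R M = 0%E, F `<=` E & E `<=` F `|` M].
Proof.
move=> mE.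
have : (completed_algebra_gen (bor R)).-sigma.-measurable E.
  by rewrite completed_caratheodory_measurable.
rewrite g_sigma_completed_algebra_genE => -[F mF [N [M [mM M0 NM]] <-]].
exists F, M; split => //; by [apply: subsetUl|apply: setUS].
Qed.

(** The sublevel sets at rational levels are Borel up to Borel null sets; the
    representative is [u] outside the countable union of these null sets and
    [0] on it. *)
Lemma borel_representative (R : realType) (u : R -> R) :
  lebesgue_measurable_fun setT u ->
  exists2 v : R -> R, measurable_fun setT v & {ae bor R, forall t, u t = v t}.
Proof.
move=> mu.
(* an enumeration of the rationals *)
pose r n : R := ratr (odflt 0 (unpickle n)).
have dec n : {FM : set R * set R |
    [/\ measurable FM.1, measurable FM.2, bor R FM.2 = 0%E,
     FM.1 `<=` [set x | u x < r n] & [set x | u x < r n] `<=` FM.1 `|` FM.2]}.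
  apply: cid.
  have : measurable ([set x | u x < r n] : set (lebesgueTypeR R)).
    rewrite -[X in measurable X]setTI (_ : [set x | _] = u @^-1` `]-oo, (r n)[).
      by apply: mu.
    by apply/seteqP; split => x /=; rewrite in_itv.
  by move=> /leb_measurable_decomp[F [M H]]; exists (F, M).
pose F n := (projT1 (dec n)).1; pose M n := (projT1 (dec n)).2.
have dF n : [/\ measurable (F n), measurable (M n), bor R (M n) = 0%E,
   F n `<=` [set x | u x < r n] & [set x | u x < r n] `<=` F n `|` M n].
  exact: (projT2 (dec n)).
pose N := \bigcup_n M n.
have mN : measurable N by apply: bigcupT_measurable => n; case: (dF n).
have N0 : bor R N = 0%E.
  apply/negligibleP => //; apply: negligible_bigcup => n.
  by have [_ mM M0 _ _] := dF n; apply/negligibleP.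
pose v x := if x \in N then 0 else u x.
exists v; last first.
  exists N; split => // x /=; rewrite /v; case: ifPn; last by [].
  by rewrite inE.
apply: (measurability _ (RGenInftyO.measurableE R)) => // _ [_ [y ->] <-].
rewrite setTI (_ : _ @^-1` _ =
    (~` N `&` \bigcup_(n in [set n | r n <= y]) F n) `|`
    (N `&` [set _ | 0 < y])).
  apply: measurableU; apply: measurableI => //.
  - exact: measurableC.
  - by apply: bigcup_measurable => n _; case: (dF n).
  - by have [y0|y0] := boolP (0 < y); rewrite ?set_true ?set_false;
      [exact: measurableT|exact: measurable0].
apply/seteqP; split => x /=; rewrite in_itv /= /v.
- case: ifPn => [/set_mem Nx y0|/negP]; first by right.
  move=> xN uy; left.
  have nNx : ~ N x by move=> Nx; apply: xN; rewrite inE.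
  split => //.
  have [q] := rat_in_itvoo uy; rewrite in_itv /= => /andP[uq qy].
  have rq : r (pickle q) = ratr q by rewrite /r pickleK.
  exists (pickle q); first by rewrite /= rq ltW.
  have [_ _ _ _] := dF (pickle q).
  move=> /(_ x); rewrite /= rq => /(_ uq)[//|Mx].
  by exfalso; apply: nNx; exists (pickle q).
- move=> [[nNx [n /= rn Fx]]|[Nx y0]]; last by rewrite mem_set.
  rewrite memNset //.
  have [_ _ _ /(_ x Fx)/= ux _] := dF n.
  exact: lt_le_trans ux rn.
Qed.

(** The Borel measure is the image of the completed one under the identity. *)
Lemma ge0_integral_leb_bor (R : realType) (D : set R) (f : R -> \bar R) :
  measurable (D : set (measurableTypeR R)) ->
  measurable_fun (D : set (measurableTypeR R)) f -> (forall x, 0 <= f x)%E ->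
  (\int[leb R]_(x in D) f x = \int[bor R]_(x in D) f x)%E.
Proof.
move=> mD mf f0.
exact: esym (ge0_integral_pushforward (@measurable_id_leb R) (leb R) mD mf
  (fun x _ => f0 x)).
Qed.

Lemma measurable_leb_itv (R : realType) (i : interval R) :
  measurable ([set` i] : set (lebesgueTypeR R)).
Proof. by apply: sub_caratheodory; exact: measurable_itv. Qed.

Lemma measurable_fun_bor_leb (R : realType) d (T : measurableType d)
    (f : R -> T) :
  measurable_fun (setT : set (measurableTypeR R)) f ->
  measurable_fun (setT : set (lebesgueTypeR R)) f.
Proof.
move=> mf _ Y mY; apply: sub_caratheodory; exact: mf.
Qed.

(** * Primitives *)

(** Integrating from [-oo] gives additivity on all intervals without a case
    analysis on the position of the origin; the functions of interest vanish
    near [-oo]. *)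
Definition cumul (R : realType) (u : R -> R) (t : R) : R :=
  \int[leb R]_(s in `]-oo, t]) u s.

Definition cumulable (R : realType) (u : R -> R) :=
  (forall t, 0 <= u t) /\
  (forall y, (leb R).-integrable `]-oo, y] (EFin \o u)).

Lemma cumulable_local (R : realType) (u : R -> R) : cumulable u ->
  locally_integrableR u.
Proof.
move=> [_ iu] c d; apply: integrableS (iu d).
- exact: measurable_leb_itv.
- exact: measurable_leb_itv.
- by move=> x /=; rewrite !in_itv /= => /andP[].
Qed.

(** Everything about primitives for the completed measure is read off from
    this single Borel function with the same integrals over intervals. *)
Lemma cumulable_borel (R : realType) (u : R -> R) : cumulable u ->
  exists v : R -> R, [/\ forall t, 0 <= v t,
    {ae bor R, forall t, u t = v t},
    forall y, (bor R).-integrable `]-oo, y] (EFin \o v),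
    locally_integrable setT v &
    forall i : interval R,
      \int[leb R]_(s in [set` i]) u s = \int[bor R]_(s in [set` i]) v s].
Proof.
move=> [u0 iu].
have mu : lebesgue_measurable_fun setT u.
  have -> : [set: R] = \bigcup_k `]-oo, (k%:R : R)]%classic.
    apply/seteqP; split => // x _ /=.
    exists (Num.truncn `|x|).+1 => //=; rewrite in_itv /=.
    by rewrite (le_trans (ler_norm x))// ltW// truncnS_gt.
  apply/measurable_fun_bigcup => k; first exact: measurable_leb_itv.
  by apply/measurable_EFinP; case/integrableP: (iu k%:R).
have [v0 mv0 uv0] := borel_representative mu.
pose v t := Num.max (v0 t) 0.
have mv : measurable_fun setT v by apply: measurable_maxr.
have vge0 t : 0 <= v t by rewrite /v le_max lexx orbT.
have uv : {ae bor R, forall t, u t = v t}.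
  apply: ae_mono uv0 => t; rewrite /v => <-.
  by rewrite max_l.
have eqI (i : interval R) : (\int[leb R]_(s in [set` i]) (u s)%:E =
    \int[bor R]_(s in [set` i]) (v s)%:E)%E.
  have mvi : measurable_fun ([set` i] : set (measurableTypeR R)) (EFin \o v).
    by apply/measurable_EFinP; exact: measurable_funTS.
  rewrite -ge0_integral_leb_bor //.
  apply: ae_eq_integral.
  - exact: measurable_leb_itv.
  - by apply: measurable_funTS; apply/measurable_EFinP.
  - apply: measurable_funTS; apply/measurable_EFinP.
    exact: measurable_fun_bor_leb.
  - by move/ae_leb_bor : uv; apply: ae_mono => t -> _.
have iv y : (bor R).-integrable `]-oo, y] (EFin \o v).
  apply/integrableP; split.
    by apply/measurable_EFinP; exact: measurable_funTS.
  under eq_integral do rewrite /= ger0_norm//.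
  rewrite -eqI; case/integrableP: (iu y) => _.
  by under eq_integral do rewrite /= ger0_norm//.
exists v; split => //; last by move=> i; rewrite /Rintegral eqI.
split => //; first exact: openT.
move=> K _ cK; have /compact_bounded[M [_ KM]] := cK.
have KM1 : K `<=` `]-oo, M + 1].
  move=> x Kx /=; rewrite in_itv /=.
  rewrite (le_trans (ler_norm x))//; apply: KM => //.
  by rewrite ltrDl.
have /integrableP[_] := iv (M + 1).
apply: le_lt_trans.
apply: ge0_subset_integral => //.
- by apply: closed_measurable; apply: compact_closed => //; exact: Rhausdorff.
- apply/measurable_EFinP; apply: measurableT_comp => //.
  exact: measurable_funTS.
Qed.

Lemma cumul_itv (R : realType) (u : R -> R) (s t : R) : cumulable u -> s <= t ->
  \int[leb R]_(r in `[s, t]) u r = cumul u t - cumul u s.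
Proof.
move=> /cumulable_borel[v [v0 uv iv lv eqI]] st; rewrite /cumul !eqI.
rewrite (Rintegral_itvB (iv t)) ?bnd_simp //.
rewrite Rintegral_itv_obnd_cbnd //.
by apply: integrableS (iv t) => // x /=; rewrite !in_itv /= => /andP[].
Qed.

Lemma cumul_ndecr (R : realType) (u : R -> R) : cumulable u ->
  {homo cumul u : s t / s <= t}.
Proof.
move=> cu s t st; rewrite -subr_ge0 -cumul_itv //.
by apply: Rintegral_ge0 => r _; case: cu.
Qed.

Lemma cumul_derivable (R : realType) (u : R -> R) : cumulable u ->
  {ae leb R, forall t, derivable (cumul u) t 1 /\ derive1 (cumul u) t = u t}.
Proof.
move=> /cumulable_borel[v [v0 uv iv lv eqI]].
apply/ae_leb_bor; have := FTC1Ny iv lv => /= /(ae_and uv).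
apply: ae_mono => t [-> ].
suff -> : (fun x : R => \int[bor R]_(t0 in `]-oo, x]) v t0) = cumul u by [].
by apply/funext => x; rewrite /cumul eqI.
Qed.

Lemma cumul_lipschitz (R : realType) (u : R -> R) (p q M : R) :
  cumulable u -> {ae leb R, forall t, p <= t <= q -> u t <= M} ->
  forall s t, p <= s -> s <= t -> t <= q ->
  cumul u t - cumul u s <= M * (t - s).
Proof.
move=> cu uM s t ps st tq.
have [st' | ts] := ltP s t; last first.
  by have -> : s = t by [apply/eqP; rewrite eq_le st ts]; rewrite !subrr mulr0.
have M0 : 0 <= M.
  (* a negative bound on [u >= 0] would make the interval a null set *)
  rewrite leNgt; apply/negP => M0.
  move/ae_leb_bor : uM => [N [mN N0 uN]].
  have : (bor R `[s, t] <= bor R N)%E.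
    apply: le_measure; rewrite ?inE//.
    move=> x /=; rewrite in_itv /= => /andP[sx xt]; apply: uN => /= H.
    have := H; rewrite (le_trans ps sx) (le_trans xt tq) => /(_ isT).
    by rewrite leNgt (lt_le_trans M0)//; case: cu.
  rewrite N0 lebesgue_measure_itv /= lte_fin st' -EFinD lee_fin subr_le0.
  by rewrite leNgt st'.
rewrite -cumul_itv // -lee_fin.
have ist := cumulable_local cu s t.
have mst := @measurable_leb_itv R `[s, t].
rewrite /Rintegral fineK; last exact: integrable_fin_num ist.
apply: (@le_trans _ _ (\int[leb R]_(x in `[s, t]) (cst M%:E x))%E).
  apply: ae_ge0_le_integral.
  - exact: mst.
  - by move=> x _; rewrite lee_fin; case: cu.
  - by case/integrableP: ist.
  - by move=> x _; rewrite lee_fin.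
  - exact: measurable_cst.
  - apply: (ae_mono _ uM) => x H; rewrite /= in_itv /= => /andP[sx xt].
    by rewrite lee_fin; apply: H; rewrite (le_trans ps sx) (le_trans xt tq).
rewrite integral_cst //=.
have -> : leb R `[s, t] = bor R `[s, t] by [].
by rewrite lebesgue_measure_itv /= lte_fin st' -EFinD -EFinM lexx.
Qed.

(** * Functions vanishing before a point *)

Lemma cumulable_vanishing (R : realType) (t1 : R) (u : R -> R) :
  (forall t, 0 <= u t) -> (forall t, t < t1 -> u t = 0) ->
  (forall y, (leb R).-integrable `[t1, y] (EFin \o u)) -> cumulable u.
Proof.
move=> u0 ut1 iu; split => // y.
rewrite integrable_mkcond; last exact: measurable_leb_itv.
have -> : (EFin \o u) \_ `]-oo, y] = (EFin \o u) \_ `[t1, y].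
  apply/funext => t; rewrite !patchE /= !mem_setE !in_itv /=.
  have [//|tt1] := leP t1 t; case: ifP => // _.
  by rewrite ut1.
by rewrite -integrable_mkcond; [exact: iu|exact: measurable_leb_itv].
Qed.

Lemma ess_bounded_cumulable (R : realType) (t1 : R) (u : R -> R) :
  lebesgue_measurable_fun setT u -> (forall t, 0 <= u t) ->
  (forall t, t < t1 -> u t = 0) -> locally_ess_bounded t1 u -> cumulable u.
Proof.
move=> mu u0 ut1 bu; apply: (cumulable_vanishing u0 ut1) => y.
have [M uM] := bu y.
have mty := @measurable_leb_itv R `[t1, y].
have muy : measurable_fun (`[t1, y] : set (lebesgueTypeR R)) (EFin \o u).
  by apply/measurable_EFinP; exact: measurable_funTS.
apply/integrableP; split; first exact: muy.
apply: (@le_lt_trans _ _ (\int[leb R]_(x in `[t1, y]) (cst `|M|%:E x))%E).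
  apply: ae_ge0_le_integral.
  - exact: mty.
  - by move=> x _; exact: abse_ge0.
  - by apply: measurableT_comp => //; exact: muy.
  - by move=> x _; rewrite lee_fin.
  - exact: measurable_cst.
  - apply: (ae_mono _ uM) => x H xty.
    by rewrite lee_fin (le_trans (H xty))// ler_norm.
rewrite integral_cst //= lte_mul_pinfty// ?lee_fin//.
have -> : leb R `[t1, y] = bor R `[t1, y] by [].
by rewrite lebesgue_measure_itv /=; case: ifP; rewrite ltry.
Qed.

Lemma cumul_vanishing (R : realType) (t1 : R) (u : R -> R) (s t : R) :
  cumulable u -> (forall r, r < t1 -> u r = 0) -> s <= t -> t <= t1 ->
  cumul u t - cumul u s <= 0.
Proof.
move=> cu ut1 st tt1; rewrite -(mul0r (t - s)).
apply: (@cumul_lipschitz _ u s t) => //.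
have : {ae leb R, forall r, r != t1}.
  apply/ae_leb_bor; exists [set t1]; split => //.
    exact: lebesgue_measure_set1.
  by move=> r /= /negP; rewrite negbK => /eqP.
apply: ae_mono => r rt1 /andP[_ rt].
by rewrite ut1 // lt_neqAle rt1 (le_trans rt).
Qed.

Lemma cumulable0 (R : realType) : cumulable (fun=> 0 : R).
Proof.
apply: (@ess_bounded_cumulable R 0) => //; first exact: measurable_cst.
move=> c; exists 0.
by apply/ae_leb_bor; apply: aeW => t _; rewrite normr0.
Qed.

(** * Monotonicity of absolutely continuous functions *)

(** The supremum of the points reached cannot be smaller than [q], since the
    step at that supremum jumps over it. *)
Lemma real_induction (R : realType) (P : R -> Prop) (p q : R) : p <= q -> P p ->
  (forall t, p <= t -> t <= q -> exists2 e, 0 < e & forall s s',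
     t - e < s -> s <= t -> t <= s' -> s' < t + e -> p <= s -> s' <= q ->
     P s -> P s') -> P q.
Proof.
move=> pq Pp step.
pose S := [set t | p <= t <= q /\ P t].
have Sp : S p by split => //; rewrite lexx.
have Sq : ubound S q by move=> t [/andP[]].
have supS : has_sup S by split; [exists p|exists q].
have pc : p <= sup S by apply: ub_le_sup Sp; exists q.
have cq : sup S <= q by apply: ge_sup Sq; exists p.
have [e e0 H] := step _ pc cq.
have [s Ss cs] := sup_adherent e0 supS.
have sc : s <= sup S by apply: ub_le_sup Ss; exists q.
have [/andP[ps sq] Ps] := Ss.
have [qc|cq'] := leP q (sup S + e / 2).
  apply: (H s q) => //.
  by rewrite (le_lt_trans qc)// ltrD2l ltr_pdivrMr// ltr_pMr// ltr1n.
have Pc : P (sup S + e / 2).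
  apply: (H s) => //; [|by lra|exact: ltW].
  by lra.
have : sup S + e / 2 <= sup S.
  apply: ub_le_sup; first by exists q.
  by split => //; apply/andP; split; lra.
by move=> h; exfalso; lra.
Qed.

Lemma derivable_is_derive1 (R : realType) (f : R -> R) (t : R) :
  derivable f t 1 -> is_derive t 1 f (derive1 f t).
Proof. by move=> df; rewrite derive1E; exact: derivableP. Qed.

Lemma is_derive1E (R : realType) (f : R -> R) (t l : R) :
  is_derive t 1 f l -> derivable f t 1 /\ derive1 f t = l.
Proof. by case=> df fl; rewrite derive1E. Qed.

(** The points [s] and [s'] lie on both sides of [t]: only there does the
    derivative at [t] control the increment. *)
Lemma derive1_ge0_near (R : realType) (f : R -> R) (t e : R) :
  derivable f t 1 -> 0 <= derive1 f t -> 0 < e ->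
  exists2 d, 0 < d &
    forall s s', t - d < s -> s <= t -> t <= s' -> s' < t + d ->
    f s <= f s' + e * (s' - s).
Proof.
move=> df f0 e0.
have : h^-1 *: (f (h *: 1 + t) - f t) @[h --> 0^'] --> derive1 f t.
  by rewrite derive1E.
move/cvgrPdist_lt => /(_ _ e0)[d /= d0 H].
have {}H h : 0 < `|h| < d -> - e < h^-1 * (f (h + t) - f t).
  move=> /andP[h0 hd]; have := H h.
  rewrite /ball_ /= sub0r normrN -normr_gt0 => /(_ hd h0).
  rewrite /GRing.scale /= mulr1 ltr_distlC => /andP[+ _].
  by apply: le_lt_trans; lra.
exists d => // s s' ds st ts' s'd.
have H1 : f s <= f t + e * (t - s).
  have [->|st'] := eqVneq s t; first by rewrite subrr mulr0 addr0.
  have {}st : s < t by rewrite lt_neqAle st' st.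
  have := H (s - t); rewrite ltr0_norm ?subr_lt0 // opprB subr_gt0 st /= subrK.
  rewrite ltrBlDr -ltrBlDl => /(_ ds).
  rewrite mulrC ltr_ndivlMr ?subr_lt0//. lra.
have H2 : f t <= f s' + e * (s' - t).
  have [->|st'] := eqVneq s' t; first by rewrite subrr mulr0 addr0.
  have {}ts' : t < s' by rewrite lt_neqAle eq_sym st' ts'.
  have := H (s' - t); rewrite gtr0_norm ?subr_gt0 // ts' /= subrK.
  rewrite ltrBlDr addrC => /(_ s'd).
  rewrite mulrC ltr_pdivlMr ?subr_gt0//. lra.
lra.
Qed.

Lemma sum_disjoint_itv_le (R : realType) (U : set R) n (I : 'I_n -> R * R) :
  measurable U -> (forall i, (I i).1 <= (I i).2) ->
  trivIset setT (fun i => `](I i).1, (I i).2[%classic) ->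
  (forall i, `](I i).1, (I i).2[ `<=` U) ->
  ((\sum_i ((I i).2 - (I i).1))%:E <= bor R U)%E.
Proof.
move=> mU I12 tI IU.
rewrite -sumEFin.
rewrite (eq_bigr (fun i => bor R `](I i).1, (I i).2[)); last first.
  move=> i _; rewrite lebesgue_measure_itv /= lte_fin.
  case: ltP => // h; congr EFin.
  by apply/eqP; rewrite subr_eq0 eq_le h I12.
rewrite -(measure_bigsetU_ord _ xpredT) //.
apply: le_measure; rewrite ?inE //; first by apply: bigsetU_measurable.
by elim/big_ind: _ => [|A B AU BU|i _];
  [exact: sub0set|rewrite subUset|exact: IU].
Qed.

(** Cover the exceptional null set by an open set [U] of measure less than the
    [d] given by absolute continuity.  Moving from [p] to [q], the steps around
    points outside [U] lose at most [e / 2] in total by the sign of the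
    derivative, and the steps made inside [U] are disjoint intervals of total
    length less than [d], hence lose at most [e / 2] as well. *)
Lemma ac_derive1_ge0_le (R : realType) (f : R -> R) (p q : R) : p <= q ->
  absolutely_continuous p q f ->
  {ae leb R, forall t, p <= t <= q -> derivable f t 1 /\ 0 <= derive1 f t} ->
  f p <= f q.
Proof.
move=> pq ac /ae_leb_bor[N [mN N0 NP]].
have [->|pq'] := eqVneq p q; first exact: lexx.
have {}pq' : 0 < q - p by rewrite subr_gt0 lt_neqAle pq' pq.
apply/ler_addgt0Pr => e e0.
have he : 0 < e / 2 by rewrite divr_gt0.
have [d d0 acd] := ac (e / 2) he.
have Noo : (bor R N < +oo)%E by rewrite N0.
have [U [oU NU UN]] := lebesgue_regularity_outer mN Noo d0.
have mU : measurable U by exact: open_measurable.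
have Ud : (bor R U < d%:E)%E.
  have -> : bor R U = (bor R (U `\` N) + bor R N)%E; last by rewrite N0 adde0.
  rewrite -[in LHS](setDUK NU) setUC.
  apply: measureU => //; first exact: measurableD.
  by apply/seteqP; split => x //= [[? ?]].
pose e2 := e / 2 / (q - p).
have e20 : 0 < e2 by rewrite !divr_gt0.
(* the list collects the steps made inside [U] on the way from [p] to [t] *)
pose P t := exists l : seq (R * R),
  [/\ pairwise (fun I J : R * R => I.2 <= J.1) l,
   forall I : R * R, I \in l -> [/\ p <= I.1, I.1 <= I.2 & I.2 <= t],
   forall I : R * R, I \in l -> `]I.1, I.2[ `<=` U &
   f p - f t <= e2 * (t - p) + \sum_(I <- l) `|f I.2 - f I.1|].
have : P q.
  apply: (real_induction pq).
    by exists [::]; split => //; rewrite big_nil !subrr mulr0 addr0.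
  move=> t pt tq.
  have [Ut|nUt] := pselect (U t).
    have [r /= r0 rU] := open_nbhs_nbhs (conj oU Ut).
    exists r => // s s' rs st ts' s'r ps s'q [l [l1 l2 l3 l4]].
    exists (rcons l (s, s')); split.
    - rewrite pairwise_rcons l1 andbT; apply/allP => I /l2[].
      by move=> *.
    - move=> I; rewrite mem_rcons inE => /orP[/eqP -> /=|/l2[? ? ?]].
        by split => //; exact: le_trans ts'.
      by split => //; lra.
    - move=> I; rewrite mem_rcons inE => /orP[/eqP -> /=|/l3 //].
      move=> x /=; rewrite in_itv /= => /andP[sx xs']; apply: rU.
      by rewrite /ball_ /= ltr_distlC; apply/andP; split; lra.
    - rewrite -cats1 big_cat big_seq1 /=.
      have := ler_norm (f s - f s'); rewrite distrC => h.
      have : 0 <= e2 * (s' - s) by apply: mulr_ge0; lra.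
      lra.
  have : ~ ~ (p <= t <= q -> derivable f t 1 /\ 0 <= derive1 f t).
    by move=> h; apply: nUt; apply: NU; apply: NP.
  rewrite notE pt tq => /(_ isT)[dft f0].
  have [r r0 H] := derive1_ge0_near dft f0 e20.
  exists r => // s s' rs st ts' s'r ps s'q [l [l1 l2 l3 l4]].
  exists l; split => //.
    by move=> I /l2[? ? ?]; split => //; lra.
  have := H s s' rs st ts' s'r. lra.
move=> [l [l1 l2 l3 l4]].
pose I (i : 'I_(size l)) := nth (0, 0) l i.
have Il i : I i \in l by exact: mem_nth.
have I12 i : (I i).1 <= (I i).2 by have [] := l2 _ (Il i).
have tI : trivIset setT (fun i => `](I i).1, (I i).2[%classic).
  have key (i j : 'I_(size l)) x : (i < j)%N ->
      `](I i).1, (I i).2[%classic x -> `](I j).1, (I j).2[%classic x -> False.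
    move=> ij /=; rewrite !in_itv /= => /andP[_ xi] /andP[jx _].
    have : (I i).2 <= (I j).1.
      by move/(pairwiseP (0, 0)) : l1; apply => //; rewrite inE.
    by rewrite leNgt (lt_trans jx xi).
  move=> i j _ _ [x [xi xj]].
  have [ij|ji|/val_inj//] := ltngtP i j; first by case: (key i j x).
  by case: (key j i x).
have sumd : \sum_i ((I i).2 - (I i).1) < d.
  rewrite -lte_fin; apply: le_lt_trans Ud; apply: sum_disjoint_itv_le => //.
  by move=> i; exact: l3.
have Ipq i : [/\ p <= (I i).1, (I i).1 <= (I i).2 & (I i).2 <= q] by exact: l2.
have := acd _ I Ipq tI sumd.
have -> : \sum_i `|f (I i).2 - f (I i).1| = \sum_(J <- l) `|f J.2 - f J.1|.
  by rewrite (big_nth (0, 0)) big_mkord.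
have : e2 * (q - p) = e / 2 by rewrite /e2 divfK// gt_eqF.
move: l4; lra.
Qed.

(** * Absolutely continuous functions *)

(** One criterion covers Lipschitz functions, compositions with Lipschitz
    functions and sums of the two kinds. *)
Lemma ac_dominated (R : realType) (p q L M : R) (f k : R -> R) :
  0 <= L -> 0 <= M -> absolutely_continuous p q f ->
  (forall s t, p <= s -> s <= t -> t <= q ->
     `|k t - k s| <= L * `|f t - f s| + M * (t - s)) ->
  absolutely_continuous p q k.
Proof.
move=> L0 M0 acf kf e e0.
have e1 : 0 < e / 2 / (L + 1) by rewrite !divr_gt0// ltr_wpDl.
have [d d0 H] := acf _ e1.
have e2 : 0 < e / 2 / (M + 1) by rewrite !divr_gt0// ltr_wpDl.
exists (Num.min d (e / 2 / (M + 1))); first by rewrite lt_min d0.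
move=> n I In tI; rewrite lt_min => /andP[/(H _ _ In tI) H1 H2].
apply: (@le_lt_trans _ _ (L * \sum_i `|f (I i).2 - f (I i).1| +
    M * \sum_i ((I i).2 - (I i).1))).
  rewrite !mulr_sumr -big_split /=; apply: ler_sum => i _.
  by have [? ? ?] := In i; apply: kf.
move: H1 H2; rewrite !ltr_pdivlMr ?ltr_wpDl//.
set A := \sum_i _; set B := \sum_i _ => H1 H2.
have A0 : 0 <= A by apply: sumr_ge0.
have B0 : 0 <= B by apply: sumr_ge0 => i _; rewrite subr_ge0; case: (In i).
nra.
Qed.

Lemma lipschitz_ac (R : realType) (p q M : R) (k : R -> R) : 0 <= M ->
  (forall s t, p <= s -> s <= t -> t <= q -> `|k t - k s| <= M * (t - s)) ->
  absolutely_continuous p q k.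
Proof.
move=> M0 kM; apply: (@ac_dominated _ p q 0 M (fun=> 0)) => //.
  move=> e e0; exists 1 => // n I _ _ _.
  by under eq_bigr do rewrite subrr normr0; rewrite big1.
by move=> s t ps st tq; rewrite mul0r add0r kM.
Qed.

Lemma ac_subset (R : realType) (p q p' q' : R) (f : R -> R) :
  p <= p' -> q' <= q -> absolutely_continuous p q f ->
  absolutely_continuous p' q' f.
Proof.
move=> pp qq acf e /acf[d d0 H]; exists d => // n I In; apply: H => i.
by have [? ? ?] := In i; split => //; [exact: le_trans pp _|exact: le_trans qq].
Qed.

Lemma lnB_le (R : realType) (m x y : R) : 0 < m -> m <= x -> x <= y ->
  ln y - ln x <= m^-1 * (y - x).
Proof.
move=> m0 mx xy.
have x0 : 0 < x := lt_le_trans m0 mx.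
have y0 : 0 < y := lt_le_trans x0 xy.
rewrite -ln_div ?posrE //.
apply: (@le_trans _ _ (y / x - 1)).
  have := @le_ln1Dx _ (y / x - 1); rewrite (addrC 1) subrK; apply.
  by rewrite ltrBrDr addNr divr_gt0.
rewrite -[X in _ - X](@divff _ x) ?gt_eqF// -mulrBl mulrC.
by apply: ler_wpM2r; rewrite ?subr_ge0// lef_pV2.
Qed.

Lemma expRB_le (R : realType) (x y z : R) : x <= y -> y <= z ->
  expR y - expR x <= expR z * (y - x).
Proof.
move=> xy yz.
apply: (@le_trans _ _ (expR y * (y - x))); last first.
  by apply: ler_wpM2r; rewrite ?subr_ge0// ler_expR.
have -> : expR x = expR y * expR (x - y) by rewrite -expRD addrC subrK.
have := expR_ge1Dx (x - y); have := expR_gt0 y. nra.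
Qed.

(** * The integral operator *)

Definition picard (R : realType) (t1 : R) (a b g h u : R -> R) (t : R) : R :=
  if t1 <= t then
    b t * expR (\int[leb R]_(s in `[t, h t]) u s) -
    a t * expR (- \int[leb R]_(s in `[g t, t]) u s)
  else 0.

Section picard.
Context (R : realType) (t1 : R) (a b g h : R -> R).
Hypothesis ma : lebesgue_measurable_fun `[t1, +oo[ a.
Hypothesis mb : lebesgue_measurable_fun `[t1, +oo[ b.
Hypothesis mg : lebesgue_measurable_fun `[t1, +oo[ g.
Hypothesis mh : lebesgue_measurable_fun `[t1, +oo[ h.
Hypothesis bb : locally_ess_bounded t1 b.
Hypothesis bh : locally_ess_bounded t1 h.
Hypothesis a_ge0 : forall t, t1 <= t -> 0 <= a t.
Hypothesis g_le : forall t, t1 <= t -> g t <= t.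
Hypothesis h_ge : forall t, t1 <= t -> t <= h t.
Hypothesis a_le_b : forall t, t1 <= t -> a t <= b t.
Implicit Types (u w y : R -> R) (t : R).

Local Notation F := (picard t1 a b g h).

Let b_ge0 t : t1 <= t -> 0 <= b t.
Proof. by move=> t1t; apply: le_trans (a_le_b t1t); exact: a_ge0. Qed.

Lemma picardE u t : cumulable u -> t1 <= t ->
  F u t = b t * expR (cumul u (h t) - cumul u t) -
          a t * expR (- (cumul u t - cumul u (g t))).
Proof.
by move=> cu t1t; rewrite /picard t1t !cumul_itv//; [exact: g_le|exact: h_ge].
Qed.

Lemma picard_lt u t : t < t1 -> F u t = 0.
Proof. by rewrite ltNge /picard => /negbTE ->. Qed.

Lemma picard_ge0 u t : cumulable u -> 0 <= F u t.
Proof.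
move=> cu; have [t1t|/picard_lt-> //] := leP t1 t.
rewrite picardE // subr_ge0 ler_pM ?expR_ge0 ?a_ge0 ?a_le_b// ler_expR.
rewrite (@le_trans _ _ 0) ?oppr_le0 ?subr_ge0//; apply: cumul_ndecr => //.
- exact: g_le.
- exact: h_ge.
Qed.

Definition increments_le u y :=
  forall s t, s <= t -> cumul u t - cumul u s <= y t - y s.

Lemma le_increments u w : cumulable u -> cumulable w ->
  (forall t, u t <= w t) -> increments_le u (cumul w).
Proof.
move=> cu cw uw s t st; rewrite -!cumul_itv //.
by apply: le_Rintegral => //;
  [exact: measurable_leb_itv|exact: cumulable_local|exact: cumulable_local].
Qed.

Lemma picard_le u y t : cumulable u -> increments_le u y -> t1 <= t ->
  F u t <= b t * expR (y (h t) - y t) - a t * expR (- (y t - y (g t))).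
Proof.
move=> cu uy t1t; rewrite picardE //.
apply: lerB; apply: ler_wpM2l; rewrite ?b_ge0 ?a_ge0 // ler_expR.
- by apply: uy; exact: h_ge.
- by rewrite lerN2; apply: uy; exact: g_le.
Qed.

Lemma picard_homo u w t : cumulable u -> cumulable w ->
  (forall t, u t <= w t) -> F u t <= F w t.
Proof.
move=> cu cw uw; have [t1t|tt1] := leP t1 t; last by rewrite !picard_lt.
by rewrite (picardE cw) //; apply: picard_le => //; exact: le_increments.
Qed.

Lemma measurable_picard u : cumulable u -> lebesgue_measurable_fun setT (F u).
Proof.
move=> cu.
have mcu : measurable_fun (setT : set R) (cumul u).
  by apply: nondecreasing_measurable => // s t; exact: cumul_ndecr.
have m1 := @measurable_leb_itv R `[t1, +oo[.
pose E t := b t * expR (cumul u (h t) - cumul u t) -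
  a t * expR (- (cumul u t - cumul u (g t))).
have mcl : lebesgue_measurable_fun `[t1, +oo[ (cumul u).
  by apply: measurable_funTS; exact: measurable_fun_bor_leb.
have mE : lebesgue_measurable_fun `[t1, +oo[ E.
  have mexp (k : R -> R) : lebesgue_measurable_fun `[t1, +oo[ k ->
      lebesgue_measurable_fun `[t1, +oo[ (fun t => expR (k t)).
    by move=> mk; apply: (measurableT_comp (@measurable_expR R) mk).
  have mch : lebesgue_measurable_fun `[t1, +oo[ (fun t => cumul u (h t)).
    exact: (measurableT_comp mcu mh).
  have mcg : lebesgue_measurable_fun `[t1, +oo[ (fun t => cumul u (g t)).
    exact: (measurableT_comp mcu mg).
  apply: measurable_funB.
  - exact: measurable_funM mb (mexp _ (measurable_funB mch mcl)).
  - apply: measurable_funM ma (mexp _ _).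
    exact: measurable_funN (measurable_funB mcl mcg).
suff -> : F u = E \_ `[t1, +oo[ by exact: (measurable_restrictT _ m1).1 mE.
apply/funext => t; rewrite patchE /= mem_setE in_itv /= andbT.
case: ifPn => t1t.
  exact: picardE.
by rewrite picard_lt // ltNge.
Qed.

(** On [[t1, c]] the exponent is at most [y H - y t1] for an essential bound
    [H] of [h]. *)
Lemma picard_dominated_ess_bounded y u : {homo y : s t / s <= t} ->
  (forall t, 0 <= u t) ->
  (forall t, t1 <= t -> u t <= b t * expR (y (h t) - y t)) ->
  locally_ess_bounded t1 u.
Proof.
move=> ndy u0 uy c.
have [B bB] := bb c; have [H hH] := bh c.
exists (B * expR (y H - y t1)).
have := ae_and bB hH; apply: ae_mono => t [bt ht] tc.
have t1t : t1 <= t by move: tc; rewrite in_itv /= => /andP[].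
rewrite ger0_norm// (le_trans (uy _ t1t))//.
apply: ler_pM; rewrite ?b_ge0 ?expR_ge0//.
  exact: le_trans (ler_norm _) (bt tc).
rewrite ler_expR lerB//; apply: ndy => //.
exact: le_trans (ler_norm _) (ht tc).
Qed.

Lemma picard_bound y u t : cumulable u -> increments_le u y -> t1 <= t ->
  F u t <= b t * expR (y (h t) - y t).
Proof.
move=> cu uy t1t; apply: le_trans (picard_le cu uy t1t) _.
by rewrite gerBl mulr_ge0 ?expR_ge0 ?a_ge0.
Qed.

Lemma picard_cumulable y u : {homo y : s t / s <= t} -> cumulable u ->
  increments_le u y -> cumulable (F u).
Proof.
move=> ndy cu uy; apply: (@ess_bounded_cumulable _ t1).
- exact: measurable_picard.
- by move=> t; exact: picard_ge0.
- by move=> t; exact: picard_lt.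
- apply: (picard_dominated_ess_bounded ndy) => [t|t t1t].
    exact: picard_ge0.
  exact: picard_bound.
Qed.

Lemma cumul_cvg (u_ : nat -> R -> R) u s t : (forall n, cumulable (u_ n)) ->
  cumulable u -> s <= t -> (forall r, nondecreasing_seq (u_ ^~ r)) ->
  (forall r, u_ n r @[n --> \oo] --> u r) ->
  cumul (u_ n) t - cumul (u_ n) s @[n --> \oo] --> cumul u t - cumul u s.
Proof.
move=> cu_ cu st nd uu.
rewrite -cumul_itv //.
under eq_fun do rewrite -cumul_itv //.
have mst := @measurable_leb_itv R `[s, t].
have ist v (cv : cumulable v) := cumulable_local cv s t.
apply: fine_cvg; rewrite /Rintegral fineK; last first.
  exact: integrable_fin_num (ist _ cu).
have -> : (\int[leb R]_(x in `[s, t]) (u x)%:E =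
    \int[leb R]_(x in `[s, t]) limn (fun n => (u_ n x)%:E))%E.
  apply: eq_integral => x _; apply/esym/cvg_lim => //.
  apply: cvg_EFin; last exact: uu.
  by apply: nearW.
apply: cvg_monotone_convergence.
- exact: mst.
- by move=> n; case/integrableP: (ist _ (cu_ n)).
- by move=> n x _; rewrite lee_fin; case: (cu_ n).
- by move=> x _ m n mn; rewrite lee_fin; exact: nd.
Qed.

Let u_ n := iter n F (fun=> 0).

(** The bound by [y] is what keeps the increasing iterates finite and their
    limit locally essentially bounded. *)
Lemma picard_fixpoint y : {homo y : s t / s <= t} ->
  (forall n, cumulable (u_ n) /\ increments_le (u_ n) y) ->
  exists2 u, cumulable u & locally_ess_bounded t1 u /\ forall t, u t = F u t.
Proof.
move=> ndy uy.
have cu_ n := (uy n).1; have ly n := (uy n).2.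
have nd1 n t : u_ n t <= u_ n.+1 t.
  elim: n t => [|n IH] t; first exact: picard_ge0 (cu_ 0).
  exact: (picard_homo _ (cu_ n) (cu_ n.+1) IH).
have nd t : nondecreasing_seq (u_ ^~ t) by apply/nondecreasing_seqP.
have ub n t : u_ n t <= if t1 <= t then b t * expR (y (h t) - y t) else 0.
  case: n => [|n] /=; case: ifPn => t1t //.
  - by rewrite mulr_ge0 ?b_ge0 ?expR_ge0.
  - exact: picard_bound (cu_ n) (ly n) t1t.
  - by rewrite picard_lt // ltNge.
pose u t := limn (u_ ^~ t).
have uu t : u_ n t @[n --> \oo] --> u t.
  apply: nondecreasing_is_cvgn => //.
  by exists (if t1 <= t then b t * expR (y (h t) - y t) else 0) => _ [n _ <-].
have u0 t : 0 <= u t.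
  apply: limr_ge; first exact: uu.
  by apply: nearW => n; case: (cu_ n).
have uub t : u t <= if t1 <= t then b t * expR (y (h t) - y t) else 0.
  by apply: limr_le; [exact: uu|apply: nearW => n; exact: ub].
have bu : locally_ess_bounded t1 u.
  apply: (picard_dominated_ess_bounded ndy) => // t t1t.
  by have := uub t; rewrite t1t.
have cu : cumulable u.
  apply: (@ess_bounded_cumulable _ t1) => //.
  - have mu_ n : lebesgue_measurable_fun setT (u_ n).
      case: n => [|n]; first exact: measurable_cst.
      exact: measurable_picard (cu_ n).
    exact: (@measurable_fun_cvg _ (lebesgueTypeR R) R setT u_ u mu_
      (fun x _ => uu x)).
  - move=> t tt1; apply/eqP; rewrite eq_le u0 andbT.
    by have := uub t; rewrite [t1 <= t]leNgt tt1.
exists u => //; split => // t.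
suff : u_ n.+1 t @[n --> \oo] --> F u t.
  move=> /cvg_lim <- //; apply/esym/cvg_lim => //.
  by have := uu t; rewrite -(cvg_shiftS (u_ ^~ t)).
rewrite /=.
have [t1t|tt1] := leP t1 t; last first.
  rewrite picard_lt //; under eq_fun do rewrite picard_lt //; exact: cvg_cst.
rewrite picardE //.
under eq_fun do rewrite picardE //.
apply: cvgB; apply: cvgMr; apply: continuous_cvg; try exact: continuous_expR.
- by apply: cumul_cvg => //; exact: h_ge.
- by apply: cvgN; apply: cumul_cvg => //; exact: g_le.
Qed.

(** * From fixed points to solutions *)

Lemma expR_cumul_derivable u t (x := fun r => expR (cumul u r)) : cumulable u ->
  derivable (cumul u) t 1 -> derive1 (cumul u) t = u t ->
  derivable x t 1 /\ derive1 x t = x t * u t.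
Proof.
move=> cu dc ct; apply: is_derive1E.
have := derivable_is_derive1 dc; rewrite ct => dct.
exact: (is_derive1_comp (is_derive_expR (cumul u t)) dct).
Qed.

(** The solution is locally Lipschitz because the fixed point is locally
    essentially bounded; this is where absolute continuity comes from. *)
Lemma fixpoint_equation_solution u (x := fun r => expR (cumul u r)) :
  cumulable u -> locally_ess_bounded t1 u -> (forall t, u t = F u t) ->
  equation_solution a b g h t1 x /\ eventually_pos_nondecr x.
Proof.
move=> cu bu uF.
have dx : {ae leb R, forall t, derivable x t 1 /\ derive1 x t = x t * u t}.
  by apply: ae_mono (cumul_derivable cu) => t []; exact: expR_cumul_derivable.
split; split.
- move=> c; have [M uM] := bu c.
  have M0 : 0 <= Num.max M 0 by rewrite le_max lexx orbT.
  have uM' : {ae leb R, forall t, t1 <= t <= c -> u t <= Num.max M 0}.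
    apply: ae_mono uM => t ut tc; rewrite le_max (le_trans (ler_norm _))//.
    by apply: ut; rewrite in_itv.
  apply: (@lipschitz_ac _ _ _ (expR (cumul u c) * Num.max M 0)).
    by rewrite mulr_ge0 ?expR_ge0.
  move=> s t t1s st tc.
  have st' := cumul_ndecr cu st; have tc' := cumul_ndecr cu tc.
  rewrite ger0_norm ?subr_ge0 ?ler_expR// (le_trans (expRB_le st' tc'))//.
  rewrite -mulrA ler_wpM2l ?expR_ge0//.
  exact: cumul_lipschitz cu uM' _ _ t1s st tc.
- apply: ae_mono dx => t [dx dxE] t1t; split => //.
  rewrite /mixed_op dxE uF picardE // /x.
  rewrite opprB !expRB.
  have cancel (X H G A B : R) : X != 0 ->
      X * (B * (H / X) - A * (G / X)) + A * G - B * H = 0 by move=> X0; field.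
  by apply: cancel; rewrite gt_eqF ?expR_gt0.
- by near=> t; exact: expR_gt0.
- exists t1; apply: ae_mono dx => t [_ ->] _.
  by rewrite mulr_ge0 ?expR_ge0//; case: cu.
Unshelve. all: by end_near. Qed.

Lemma fixpoint_integral_inequality u : cumulable u -> (forall t, u t = F u t) ->
  integral_inequality_solution a b g h t1 u.
Proof.
move=> cu uF; split.
- exact: cumulable_local.
- by case: cu.
- by move=> t tt1; rewrite uF picard_lt.
- by move=> t t1t; rewrite [leRHS]uF /picard t1t.
Qed.

(** * From solutions to fixed points *)

Lemma integral_inequality_fixpoint w :
  integral_inequality_solution a b g h t1 w ->
  exists2 u, cumulable u & locally_ess_bounded t1 u /\ forall t, u t = F u t.
Proof.
move=> [iw w0 wt1 wF].
have cw : cumulable w by apply: (cumulable_vanishing w0 wt1) => y; exact: iw.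
have ndw := cumul_ndecr cw.
have Fw t : F w t <= w t.
  by have [t1t|tt1] := leP t1 t; [rewrite /picard t1t wF|rewrite picard_lt].
apply: (picard_fixpoint ndw).
have H n : cumulable (u_ n) /\ forall t, u_ n t <= w t.
  elim: n => [|n [cu uw]]; first by split => //; exact: cumulable0.
  split; first exact: picard_cumulable ndw cu (le_increments cu cw uw).
  by move=> t; apply: le_trans (Fw t); exact: (picard_homo _ cu cw uw).
by move=> n; have [cu uw] := H n; split => //; exact: le_increments.
Qed.

Section supersolution.
Variables (x : R -> R) (T1 : R).
Hypothesis T1t1 : T1 <= t1.
Hypothesis gT1 : forall t, t1 <= t -> T1 <= g t.
Hypothesis xpos : forall t, T1 <= t -> 0 < x t.
Hypothesis acx : forall c, absolutely_continuous T1 c x.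
Hypothesis dx : {ae leb R, forall t, T1 <= t ->
  [/\ derivable x t 1, 0 <= derive1 x t & 0 <= mixed_op a b g h x t]}.

Lemma supersolution_ndecr s t : T1 <= s -> s <= t -> x s <= x t.
Proof.
move=> T1s st; apply: (ac_derive1_ge0_le st); first exact: ac_subset (acx t).
by apply: ae_mono dx => r H /andP[sr _]; have [] := H (le_trans T1s sr).
Qed.

(** Being constant before [t1], [y] also bounds the increments there of
    primitives of functions vanishing before [t1]. *)
Let y t := ln (x (Num.max t t1)).

Let yE t : t1 <= t -> y t = ln (x t).
Proof. by move=> t1t; rewrite /y max_l. Qed.

Lemma supersolution_ln_ndecr : {homo y : s t / s <= t}.
Proof.
move=> s t st; rewrite /y ler_ln ?posrE.
- apply: supersolution_ndecr; first by rewrite le_max T1t1 orbT.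
  by rewrite ge_max !le_max st lexx orbT.
- by apply: xpos; rewrite le_max T1t1 orbT.
- by apply: xpos; rewrite le_max T1t1 orbT.
Qed.

(** The bound on the integrals gives [exp (int_t^(h t) u) <= x (h t) / x t] and
    [exp (- int_(g t)^t u) >= x (g t) / x t].  If [g t < t1], the second one
    uses [x (g t) <= x t1], which holds since [x] is nondecreasing already from
    [T1 <= g t] on. *)
Lemma supersolution_picard u t : cumulable u -> increments_le u y ->
  t1 <= t -> 0 <= mixed_op a b g h x t -> F u t <= derive1 x t / x t.
Proof.
move=> cu uy t1t Lx; have xt := xpos (le_trans T1t1 t1t).
have xh := xpos (le_trans (le_trans T1t1 t1t) (h_ge t1t)).
apply: le_trans (picard_le cu uy t1t) _.
rewrite ler_pdivlMr// mulrBl opprB.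
have -> : b t * expR (y (h t) - y t) * x t = b t * x (h t).
  rewrite !yE //; last exact: le_trans (h_ge t1t).
  by rewrite expRB !lnK ?posrE// -mulrA divfK// gt_eqF.
have : a t * x (g t) <= a t * expR (y (g t) - y t) * x t.
  rewrite -mulrA ler_wpM2l ?a_ge0// expRB (yE t1t) [X in _ / X]lnK ?posrE//.
  rewrite divfK ?gt_eqF// /y lnK ?posrE; last first.
    by apply: xpos; rewrite le_max T1t1 orbT.
  by apply: supersolution_ndecr; [exact: gT1|rewrite le_max lexx].
move: Lx; rewrite /mixed_op; lra.
Qed.

(** Induction step: [F u <= (ln x)'] almost everywhere, so [ln x - int (F u)] is
    nondecreasing. *)
Lemma supersolution_increments u : cumulable u -> increments_le u y ->
  cumulable (F u) -> increments_le (F u) y.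
Proof.
move=> cu uy cF.
have late s t : t1 <= s -> s <= t -> cumul (F u) t - cumul (F u) s <= y t - y s.
  move=> t1s st; have t1t := le_trans t1s st.
  have T1s := le_trans T1t1 t1s.
  pose f := (@ln R \o x) - cumul (F u).
  suff : f s <= f t by rewrite /f !fctE /= !yE //; lra.
  have [M FM] := picard_dominated_ess_bounded supersolution_ln_ndecr
    (fun r => picard_ge0 r cu) (fun r => picard_bound cu uy) t.
  apply: (ac_derive1_ge0_le st).
    have xt1 := xpos T1t1.
    have M0 : 0 <= Num.max M 0 by rewrite le_max lexx orbT.
    apply: (@ac_dominated _ s t (x t1)^-1 (Num.max M 0) x) => //.
    - by rewrite invr_ge0 ltW.
    - exact: ac_subset (acx t).
    move=> p q sp pq qt; have t1p := le_trans t1s sp.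
    have T1p := le_trans T1s sp.
    have xpq := supersolution_ndecr T1p pq.
    have -> : f q - f p =
        (ln (x q) - ln (x p)) - (cumul (F u) q - cumul (F u) p).
      by rewrite /f !fctE /=; lra.
    apply: le_trans (ler_normB _ _) _; apply: lerD.
      rewrite !ger0_norm ?subr_ge0 //.
        exact: lnB_le (supersolution_ndecr T1t1 t1p) xpq.
      by rewrite ler_ln ?posrE ?xpos// (le_trans T1p).
    rewrite ger0_norm ?subr_ge0; last exact: cumul_ndecr cF _ _ pq.
    apply: (cumul_lipschitz cF _ sp pq qt).
    apply: ae_mono FM => r Fr /andP[sr rt].
    rewrite le_max (le_trans (ler_norm _))//.
    by apply: Fr; rewrite in_itv /= rt (le_trans t1s).
  have := ae_and dx (cumul_derivable cF); apply: ae_mono => r [+ [dcr cr]].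
  move=> + /andP[sr rt] => /(_ (le_trans T1s sr))[dxr _ Lx].
  have t1r := le_trans t1s sr.
  have xr := xpos (le_trans T1s sr).
  have dlnx := is_derive1_comp (is_derive1_ln xr) (derivable_is_derive1 dxr).
  have dcr' := derivable_is_derive1 dcr; rewrite cr in dcr'.
  have [dfr ->] := is_derive1E (is_deriveB dlnx dcr').
  split; first exact: dfr.
  by rewrite subr_ge0 mulrC; exact: supersolution_picard.
move=> s t st.
have [tt1|/ltW t1t] := leP t t1.
  apply: (@le_trans _ _ 0); last by rewrite subr_ge0 supersolution_ln_ndecr.
  apply: (cumul_vanishing cF _ st tt1) => r; exact: picard_lt.
have [st1|/ltW t1s] := leP s t1; last exact: late.
have -> : y s = y t1 by rewrite /y max_r // maxxx.
have := late _ _ (lexx t1) t1t.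
have := cumul_vanishing cF (fun r => @picard_lt u r) st1 (lexx t1).
lra.
Qed.

Lemma supersolution_fixpoint :
  exists2 u, cumulable u & locally_ess_bounded t1 u /\ forall t, u t = F u t.
Proof.
have nd := supersolution_ln_ndecr.
apply: (picard_fixpoint nd).
elim=> [|n [cu uy]].
  split; first exact: cumulable0.
  move=> s t st; apply: (@le_trans _ _ 0); last by rewrite subr_ge0 nd.
  by apply: (@cumul_vanishing _ t) => //; exact: cumulable0.
have cF : cumulable (F (u_ n)) := picard_cumulable nd cu uy.
by split => //; exact: supersolution_increments.
Qed.

End supersolution.

End picard.

Theorem theorem2 (R : realType) (t0 : R) (a b g h : R -> R)
  (ma : lebesgue_measurable_fun `[t0, +oo[ a)
  (mb : lebesgue_measurable_fun `[t0, +oo[ b)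
  (mg : lebesgue_measurable_fun `[t0, +oo[ g)
  (mh : lebesgue_measurable_fun `[t0, +oo[ h)
  (ba : locally_ess_bounded t0 a) (bb : locally_ess_bounded t0 b)
  (bg : locally_ess_bounded t0 g) (bh : locally_ess_bounded t0 h)
  (a_ge0 : forall t, t0 <= t -> 0 <= a t)
  (b_ge0 : forall t, t0 <= t -> 0 <= b t)
  (g_le : forall t, t0 <= t -> g t <= t)
  (h_ge : forall t, t0 <= t -> t <= h t)
  (g_oo : g t @[t --> +oo] --> +oo)
  (a_le_b : forall t, t0 <= t -> a t <= b t) :
  let C1 := exists T x, [/\ t0 <= T, inequality_solution a b g h T x &
                           eventually_pos_nondecr x] in
  let C2 := exists t1 u, t0 <= t1 /\
                         integral_inequality_solution a b g h t1 u in
  let C3 := exists T x, [/\ t0 <= T, equation_solution a b g h T x &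
                           eventually_pos_nondecr x] in
  (C1 <-> C2) /\ (C2 <-> C3).
Proof.
move=> C1 C2 C3.
have mS t1 (f : R -> R) : t0 <= t1 -> lebesgue_measurable_fun `[t0, +oo[ f ->
    lebesgue_measurable_fun `[t1, +oo[ f.
  move=> t01; apply: measurable_funS; first exact: measurable_leb_itv.
  by move=> t /=; rewrite !in_itv /= !andbT; exact: le_trans.
have bS t1 (f : R -> R) : t0 <= t1 -> locally_ess_bounded t0 f ->
    locally_ess_bounded t1 f.
  move=> t01 bf c; have [M fM] := bf c; exists M; apply: ae_mono fM => t fM.
  rewrite in_itv /= => /andP[t1t tc].
  by apply: fM; rewrite in_itv /= tc (le_trans t01).
have S t1 t : t0 <= t1 -> t1 <= t -> t0 <= t by exact: le_trans.
pose fixpoint := exists t1 u,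
  [/\ t0 <= t1, cumulable u, locally_ess_bounded t1 u &
   forall t, u t = picard t1 a b g h u t].
have fix2 : fixpoint -> C2.
  move=> [t1 [u [t01 cu bu uF]]]; exists t1, u; split => //.
  exact: fixpoint_integral_inequality cu uF.
have fix3 : fixpoint -> C3.
  move=> [t1 [u [t01 cu bu uF]]]; exists t1, (fun t => expR (cumul u t)).
  have [||eq pos] // := fixpoint_equation_solution (t1 := t1) _ _ cu bu uF.
  - by move=> t t1t; apply: g_le; exact: S t1t.
  - by move=> t t1t; apply: h_ge; exact: S t1t.
have fix_of2 : C2 -> fixpoint.
  move=> [t1 [w [t01 sw]]].
  have [||||u cu [bu uF]] // := integral_inequality_fixpoint
    (mS _ _ t01 ma) (mS _ _ t01 mb) (mS _ _ t01 mg) (mS _ _ t01 mh)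
    (bS _ _ t01 bb) (bS _ _ t01 bh) _ _ _ _ sw.
  - by move=> t /(S _ _ t01); exact: a_ge0.
  - by move=> t /(S _ _ t01); exact: g_le.
  - by move=> t /(S _ _ t01); exact: h_ge.
  - by move=> t /(S _ _ t01); exact: a_le_b.
  by exists t1, u.
have fix_of1 : C1 -> fixpoint.
  move=> [T [x [t0T [acx Lx] [[A [_ xA]] [B xB]]]]].
  pose T1 := Num.max T (Num.max (A + 1) B).
  have [TT1 AT1 BT1] : [/\ T <= T1, A + 1 <= T1 & B <= T1].
    by rewrite /T1 !le_max !lexx !orbT.
  move/cvgryPge : g_oo => /(_ T1)[D [_ gD]].
  pose t1 := Num.max T1 (D + 1).
  have T1t1 : T1 <= t1 by rewrite le_max lexx.
  have Dt1 : D + 1 <= t1 by rewrite le_max lexx orbT.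
  have t01 : t0 <= t1 := le_trans t0T (le_trans TT1 T1t1).
  have gT1 t : t1 <= t -> T1 <= g t by move=> t1t; apply: gD; lra.
  have xpos t : T1 <= t -> 0 < x t by move=> T1t; apply: xA; lra.
  have dx : {ae leb R, forall t, T1 <= t ->
      [/\ derivable x t 1, 0 <= derive1 x t & 0 <= mixed_op a b g h x t]}.
    apply: ae_mono (ae_and Lx xB) => t [LT BT] T1t.
    have [dxt Lt] := LT (le_trans TT1 T1t).
    by split => //; exact: BT (le_trans BT1 T1t).
  have [||||u cu [bu uF]] := supersolution_fixpoint
    (mS _ _ t01 ma) (mS _ _ t01 mb) (mS _ _ t01 mg) (mS _ _ t01 mh)
    (bS _ _ t01 bb) (bS _ _ t01 bh) _ _ _ _
    T1t1 gT1 xpos (fun c => ac_subset TT1 (lexx c) (acx c)) dx.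
  - by move=> t /(S _ _ t01); exact: a_ge0.
  - by move=> t /(S _ _ t01); exact: g_le.
  - by move=> t /(S _ _ t01); exact: h_ge.
  - by move=> t /(S _ _ t01); exact: a_le_b.
  by exists t1, u.
have C31 : C3 -> C1.
  move=> [T [x [t0T [acx Lx] ev]]]; exists T, x; split => //; split => //.
  by apply: ae_mono Lx => t Lt Tt; have [dxt ->] := Lt Tt.
split; split.
- by move=> /fix_of1/fix2.
- by move=> /fix_of2/fix3/C31.
- by move=> /fix_of2/fix3.
- by move=> /C31/fix_of1/fix2.
Qed.
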